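(* Let $A$ be a real symmetric $n\times n$ matrix, $i\in[n]$, and $B$ a real symmetric $m\times m$ matrix. Then the direct sum $A\oplus B$ has the $i$-SNIP if and only if $A$ has the $i$-SNIP and $B$ is nonsingular.
   Context: A symmetric matrix $M$ has the $i$-SNIP if $X=O$ is the only real symmetric matrix $X$ (of the same size) with $M\circ X=O$, $I\circ X=O$ ($\circ$ the entrywise product) and $(MX)(i,:]=O$, where $(MX)(i,:]$ is $MX$ with row $i$ deleted. In $A\oplus B$ the index $i$ refers to the $i$-th row/column, lying in the $A$ block. *)

(* Defs.v *)
From HB Require Import structures.
From mathcomp Require Import all_boot all_order all_algebra.
From mathcomp Require Import reals.

Set Implicit Arguments.
Unset Strict Implicit.
Unset Printing Implicit Defensive.

Import Order.TTheory GRing.Theory Num.Theory.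
Local Open Scope ring_scope.

Definition hadamard (R : realType) (m n : nat) (A B : 'M[R]_(m, n)) :
  'M[R]_(m, n) := map2_mx *%R A B.

(* Only meant for symmetric M; symmetry of M is a separate hypothesis. *)
Definition SNIP (R : realType) (n : nat) (i : 'I_n) (M : 'M[R]_n) : Prop :=
  forall X : 'M[R]_n, X^T = X ->
    hadamard M X = 0 -> hadamard 1%:M X = 0 -> row' i (M *m X) = 0 -> X = 0.

Definition direct_sum (R : realType) (n m : nat) (A : 'M[R]_n) (B : 'M[R]_m) :
  'M[R]_(n + m) := block_mx A 0 0 B.

(* Main.v *)
Require Import Defs.
From HB Require Import structures.
From mathcomp Require Import all_boot all_order all_algebra.
From mathcomp Require Import reals.

Set Implicit Arguments.
Unset Strict Implicit.
Unset Printing Implicit Defensive.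

Import Order.TTheory GRing.Theory Num.Theory.
Local Open Scope ring_scope.

(** Write a symmetric [X] in blocks [[P, Q], [Q^T, S]].  The SNIP conditions on
    [X] for the direct sum split into support conditions on [P] and [S] (with
    respect to [A] and [B]), the vanishing of [A P] and [A Q] outside row [i],
    and [B Q^T = 0], [B S = 0].  If [B] is invertible, only [P] survives.  If
    [B y = 0] with [y != 0], then [P = 0], [S = 0], [Q = x y^T] is a nonzero
    solution, where [x] is a nonzero solution of the [n - 1] equations in [n]
    unknowns saying that [A x] vanishes outside row [i]. *)

Lemma row'_mul (R : pzSemiRingType) (m n p : nat) (i : 'I_m) (A : 'M[R]_(m, n))
    (B : 'M[R]_(n, p)) :
  row' i (A *m B) = row' i A *m B.
Proof. by rewrite !row'Esub mul_rowsub_mx. Qed.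

Lemma row'_lshift_block_mx_eq0 (V : nmodType) (m1 m2 n1 n2 : nat) (i : 'I_m1)
    (P : 'M[V]_(m1, n1)) (Q : 'M[V]_(m1, n2))
    (S : 'M[V]_(m2, n1)) (T : 'M[V]_(m2, n2)) :
  (row' (lshift m2 i) (block_mx P Q S T) == 0) =
  [&& row' i P == 0, row' i Q == 0, S == 0 & T == 0].
Proof.
case: m1 => [|m1] in i P Q *; first by case: i.
by rewrite block_mxEv row'Ku col_mx_eq0 row'_row_mx !row_mx_eq0 -andbA.
Qed.

Lemma row_full_row'F (F : fieldType) (m n : nat) (i : 'I_m) (A : 'M[F]_(m, n)) :
  (m <= n)%N -> row_full (row' i A) = false.
Proof.
move=> le_mn; apply: ltn_eqF; apply: leq_trans le_mn.
by rewrite -[ltnRHS](ltn_predK (ltn_ord i)) ltnS rank_leq_row.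
Qed.

Lemma exists_mulmx_eq0 (F : fieldType) (m n : nat) (A : 'M[F]_(m, n)) :
  ~~ row_full A -> exists2 x : 'cV[F]_n, x != 0 & A *m x = 0.
Proof.
rewrite -cokermx_eq0 => /matrix0Pn[j [k Cjk_neq0]].
exists (col k (cokermx A)); first by apply/cV0Pn; exists j; rewrite mxE.
by rewrite colE mulmxA mulmx_coker mul0mx.
Qed.

Lemma mul_cV_rV_eq0 (F : fieldType) (m n : nat) (x : 'cV[F]_m) (y : 'rV[F]_n) :
  (x *m y == 0) = (x == 0) || (y == 0).
Proof.
have [-> | y_neq0] := eqVneq y 0; first by rewrite mulmx0 eqxx orbT.
by rewrite orbF mulmx_free_eq0 // /row_free rank_rV y_neq0.
Qed.

Lemma hadamardm0 (R : realType) (m n : nat) (A : 'M[R]_(m, n)) :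
  hadamard A 0 = 0.
Proof. exact: map2_mx0. Qed.

Lemma hadamard_direct_sum (R : realType) (n m : nat) (A : 'M[R]_n) (B : 'M[R]_m)
    (P : 'M[R]_n) (Q : 'M[R]_(n, m)) (S : 'M[R]_(m, n)) (T : 'M[R]_m) :
  hadamard (direct_sum A B) (block_mx P Q S T) =
  direct_sum (hadamard A P) (hadamard B T).
Proof. by rewrite /hadamard map2_block_mx !map2_0mx. Qed.

Lemma direct_sum_eq0 (R : realType) (n m : nat) (A : 'M[R]_n) (B : 'M[R]_m) :
  (direct_sum A B == 0) = (A == 0) && (B == 0).
Proof. by rewrite block_mx_eq0 !eqxx. Qed.

Lemma mul_direct_sum_block (R : realType) (n m p q : nat) (A : 'M[R]_n)
    (B : 'M[R]_m) (P : 'M[R]_(n, p)) (Q : 'M[R]_(n, q)) (S : 'M[R]_(m, p))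
    (T : 'M[R]_(m, q)) :
  direct_sum A B *m block_mx P Q S T =
  block_mx (A *m P) (A *m Q) (B *m S) (B *m T).
Proof. by rewrite mulmx_block !mul0mx !addr0 !add0r. Qed.

Definition off_pattern (R : realType) (n : nat) (M X : 'M[R]_n) : Prop :=
  [/\ X^T = X, hadamard M X = 0 & hadamard 1%:M X = 0].

Lemma SNIP_off_patternP (R : realType) (n : nat) (i : 'I_n) (M : 'M[R]_n) :
  SNIP i M <-> forall X, off_pattern M X -> row' i (M *m X) = 0 -> X = 0.
Proof.
split=> [snipM X [symX MX0 IX0] | snipM X symX MX0 IX0]; first exact: snipM.
by apply: snipM.
Qed.

Lemma off_pattern0 (R : realType) (n : nat) (M : 'M[R]_n) : off_pattern M 0.
Proof. by split; rewrite ?trmx0 ?hadamardm0. Qed.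

Section DirectSum.

Variables (R : realType) (n m : nat) (i : 'I_n) (A : 'M[R]_n) (B : 'M[R]_m).

Lemma off_pattern_direct_sumP (P : 'M[R]_n) (Q : 'M[R]_(n, m))
    (Q' : 'M[R]_(m, n)) (S : 'M[R]_m) :
  off_pattern (direct_sum A B) (block_mx P Q Q' S) <->
  [/\ off_pattern A P, Q' = Q^T & off_pattern B S].
Proof.
rewrite /off_pattern scalar_mx_block !hadamard_direct_sum tr_block_mx.
split=> [[/eq_block_mx[symP _ <- symS] /eqP + /eqP] | ].
  by rewrite !direct_sum_eq0 => /andP[/eqP AP /eqP BS] /andP[/eqP IP /eqP IS].
move=> [[-> -> ->] -> [-> -> ->]]; rewrite trmxK.
by split=> //; apply/eqP; rewrite direct_sum_eq0 !eqxx.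
Qed.

Lemma row'_mul_direct_sum_eq0P (P : 'M[R]_n) (Q : 'M[R]_(n, m))
    (Q' : 'M[R]_(m, n)) (S : 'M[R]_m) :
  row' (lshift m i) (direct_sum A B *m block_mx P Q Q' S) = 0 <->
  [/\ row' i (A *m P) = 0, row' i (A *m Q) = 0, B *m Q' = 0 & B *m S = 0].
Proof.
rewrite mul_direct_sum_block; split=> [/eqP | [rAP rAQ BQ' BS]].
  by rewrite row'_lshift_block_mx_eq0 => /and4P[/eqP ? /eqP ? /eqP ? /eqP ?].
by apply/eqP; rewrite row'_lshift_block_mx_eq0 rAP rAQ BQ' BS !eqxx.
Qed.

Lemma SNIP_direct_sum :
  SNIP i A -> B \in unitmx -> SNIP (lshift m i) (direct_sum A B).
Proof.
move=> /SNIP_off_patternP snipA unitB; apply/SNIP_off_patternP=> X.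
rewrite -[X]submxK => /off_pattern_direct_sumP[offP QE _].
case/row'_mul_direct_sum_eq0P=> rAP _ BQ BS.
have injB p : injective (mulmx B : 'M_(m, p) -> 'M_(m, p)).
  by apply: row_full_inj; rewrite row_full_unit.
have S0 : drsubmx X = 0 by apply: injB; rewrite BS mulmx0.
have Q'0 : dlsubmx X = 0 by apply: injB; rewrite BQ mulmx0.
have Q0 : ursubmx X = 0 by apply: trmx_inj; rewrite -QE Q'0 trmx0.
by rewrite (snipA _ offP rAP) Q0 Q'0 S0 block_mx0.
Qed.

Lemma SNIP_direct_suml : SNIP (lshift m i) (direct_sum A B) -> SNIP i A.
Proof.
move=> /SNIP_off_patternP snipAB; apply/SNIP_off_patternP=> P offP rAP.
suff /eqP : direct_sum P (0 : 'M_m) = 0.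
  by rewrite direct_sum_eq0 => /andP[/eqP].
apply: snipAB.
- apply/off_pattern_direct_sumP; rewrite trmx0; split=> //.
  exact: off_pattern0.
- by apply/row'_mul_direct_sum_eq0P; rewrite !mulmx0 row'_const.
Qed.

Lemma SNIP_direct_sum_unitmx :
  SNIP (lshift m i) (direct_sum A B) -> B \in unitmx.
Proof.
move=> /SNIP_off_patternP snipAB; rewrite -row_full_unit.
apply/negPn/negP => /exists_mulmx_eq0[y y_neq0 By].
have /negbT/exists_mulmx_eq0[x x_neq0 rAx] := row_full_row'F i A (leqnn n).
have /eqP : block_mx 0 (x *m y^T) (x *m y^T)^T 0 = 0 :> 'M_(n + m).
  apply: snipAB.
  - by apply/off_pattern_direct_sumP; split=> //; apply: off_pattern0.
  - apply/row'_mul_direct_sum_eq0P; split; rewrite ?mulmx0 ?row'_const //.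
    + by rewrite row'_mul mulmxA rAx mul0mx.
    + by rewrite trmx_mul trmxK mulmxA By mul0mx.
rewrite block_mx_eq0 => /and4P[_ + _ _].
by rewrite mul_cV_rV_eq0 trmx_eq0 (negPf x_neq0) (negPf y_neq0).
Qed.

End DirectSum.

Theorem proposition3p5 (R : realType) (n m : nat) (i : 'I_n)
    (A : 'M[R]_n) (B : 'M[R]_m) (symA : A^T = A) (symB : B^T = B) :
  SNIP (lshift m i) (direct_sum A B) <-> SNIP i A /\ B \in unitmx.
Proof.
split=> [snipAB | [snipA unitB]]; last exact: SNIP_direct_sum.
split; first exact: SNIP_direct_suml snipAB.
exact: SNIP_direct_sum_unitmx snipAB.
Qed.
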